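(* Let $p$ be a prime, $k\ge1$, $q=p^k$. Every integer of the form $$D=AB^{q-1},$$ where $A,B\in\mathbb Z$ satisfy $\gcd(A,q-1)=1$ and $B\equiv A\pmod q$, is an integer group determinant of $GA(1,q)$.
   Context: For a finite group $G=\{g_1,\dots,g_n\}$ and an element $\sum_{g\in G}a_g g$ of the group ring $\mathbb Z[G]$ (all $a_g\in\mathbb Z$), the group determinant is $D\left(\sum_{g\in G}a_g g\right)=\det\left(a_{g_ig_j^{-1}}\right)_{i,j=1}^n$. An integer group determinant of $G$ is any integer of this form. The general affine group of degree one over $\mathbb F_q$ is $GA(1,q)=\left\{\begin{pmatrix} a & b\\ 0 & 1\end{pmatrix}: a\in\mathbb F_q^*,\ b\in\mathbb F_q\right\}$ under matrix multiplication. *)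

(* Defs.v *)
From HB Require Import structures.
From mathcomp Require Import all_boot all_order all_algebra all_fingroup.
Set Implicit Arguments. Unset Strict Implicit. Unset Printing Implicit Defensive.
Import GRing.Theory.
Local Open Scope ring_scope.

(* Group determinant of a finite group G (a subset of a finGroupType gT,
   enumerated as g_1,...,g_n by enum_val) of the group-ring element
   sum_{g in G} a g * g : det (a (g_i g_j^-1))_{i,j}.  Only the values of a
   on G matter.  The enumeration order does not affect the determinant. *)
Definition group_det (gT : finGroupType) (G : {set gT}) (a : gT -> int) : int :=
  \det (\matrix_(i < #|G|, j < #|G|)
          a ((@enum_val _ (mem G) i) * (@enum_val _ (mem G) j)^-1)%g).

Definition is_int_group_det (gT : finGroupType) (G : {set gT}) (n : int) : Prop :=
  exists a : gT -> int, group_det G a = n.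

(* GA(1,F) = { [[a, b], [0, 1]] : a in F^*, b in F } inside GL_2(F). *)
Definition GA1 (F : finFieldType) : {set {'GL_2[F]}} :=
  [set g : {'GL_2[F]} | (GLval g (@Ordinal 2 1 isT) (@Ordinal 2 0 isT) == 0)
                     && (GLval g (@Ordinal 2 1 isT) (@Ordinal 2 1 isT) == 1)].

(* Main.v *)
(* Write GA(1,q) = N ><| H with N the translations and H = <h> the dilations, of
   order q - 1, and let x be a nontrivial translation and s_H the sum of H.
   Shifting by multiples of s_H, write A = m + t(q - 1) with m > 0, and let
   B = A + cq.  The element u + (t + c) s_H - c x s_H with
   u = 1 + h + ... + h^(m-1) has determinant A B^(q-1).  Indeed s_H u = m s_H, so
   m times it is (m + (t + c - c x) s_H) u.  Left multiplication by s_H factors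
   through the incidence matrix P of the right cosets of H, so Sylvester's
   determinant identity reduces the first factor to a q x q determinant; since H
   permutes the nontrivial translations simply transitively, P x P^T = J - 1 with
   J the all-ones matrix, and that determinant is det(B - cJ) = B^(q-1) (B - cq).
   It remains to see that D(u) = m^q.  Over Z[X] put f(X) = D(1 - X h).  As h and
   h^m act by conjugate permutations, D(sum X^i h^i) f(X) = f(X^m), and cancelling
   the factor (X - 1)^e of f and putting X = 1 gives D(u) = m^e, with e independent
   of m; for m = q one has u = 1 + s_H, whose determinant q^q gives e = q. *)

Require Import Defs.
From HB Require Import structures.
From mathcomp Require Import all_boot all_order all_algebra all_fingroup.
From mathcomp Require Import cyclic frobenius ring zify.
Import GRing.Theory Num.Theory.
Local Open Scope ring_scope.
Set Implicit Arguments.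
Unset Strict Implicit.
Unset Printing Implicit Defensive.

(** * Determinants of low-rank perturbations of scalar matrices *)

(** Sylvester's identity, with powers of [d] to avoid division: a unipotent column operation and a
    row operation of determinant [d ^+ s] make the same block matrix [Z] triangular in two ways. *)
Lemma mul_det_scalar_add (R : comNzRingType) (r s : nat) (d : R)
    (X : 'M[R]_(r, s)) (Y : 'M[R]_(s, r)) :
  d ^+ s * \det (d%:M + X *m Y) = d ^+ r * \det (d%:M + Y *m X).
Proof.
pose Z := block_mx (d%:M : 'M_r) (- X) Y (1%:M : 'M_s).
have detZ : \det Z = \det (d%:M + X *m Y).
  have E : Z *m block_mx 1%:M 0 (- Y) 1%:M = block_mx (d%:M + X *m Y) (- X) 0 1%:M.
    rewrite /Z mulmx_block !mulmx1 !mulmx0 !mul1mx !add0r mulNmx mulmxN opprK.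
    by rewrite subrr.
  have := congr1 determinant E.
  by rewrite det_mulmx det_lblock det_ublock !det1 !mulr1.
have E : block_mx 1%:M 0 (- Y) d%:M *m Z = block_mx d%:M (- X) 0 (d%:M + Y *m X).
  rewrite /Z mulmx_block !mul1mx !mul0mx !addr0 !mulNmx mulmxN opprK mulmx1.
  by rewrite mul_mx_scalar mul_scalar_mx addNr addrC.
have := congr1 determinant E.
by rewrite det_mulmx det_lblock det_ublock det1 !det_scalar detZ mul1r.
Qed.

Lemma det_scalar_sub_const (d c : int) (q : nat) : (1 < q)%N ->
  \det (d%:M - const_mx c : 'M[int]_q) = (d - c * q%:Z) * d ^+ q.-1.
Proof.
(* The rank-one case of Sylvester's identity gives the claim only after cancelling [d]; for [d = 0]
   the matrix has two equal rows. *)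
move=> q_gt1; have [-> | d_neq0] := eqVneq d 0.
  rewrite expr0n -subn1 subn_eq0 leqNgt q_gt1 mulr0.
  have q_gt0 : (0 < q)%N by apply: ltnW.
  apply: (determinant_alternate (i1 := Ordinal q_gt0) (i2 := Ordinal q_gt1)) => //.
  by move=> j; rewrite !mxE !mul0rn.
apply: (mulfI d_neq0); rewrite -{1}[d]expr1.
have -> : d%:M - const_mx c = d%:M + const_mx (- c) *m (const_mx 1 : 'rV_q) :> 'M_q.
  congr (_ + _); apply/matrixP=> i j; rewrite !mxE big_ord1 !mxE.
  by rewrite mulr1.
rewrite mul_det_scalar_add det_mx11 !mxE mulr1n.
under eq_bigr do rewrite !mxE.
rewrite sumr_const card_ord mul1r.
have -> : d ^+ q = d * d ^+ q.-1 by rewrite -exprS (ltn_predK q_gt1).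
by rewrite -mulr_natr natz /=; ring.
Qed.

(** * Group matrices and incidence matrices of right cosets *)

Section GroupMatrix.

Variables (gT : finGroupType) (G : {group gT}) (R : comNzRingType).
Implicit Types (a b : gT -> R) (g h : gT) (H : {group gT}).

Local Notation elt i := (@enum_val _ (mem G) i).

(** The regular representation of the group ring. The coefficients are kept general because both
    [int] and [{poly int}] serve below. *)
Definition group_mx a : 'M[R]_#|G| := \matrix_(i, j) a (elt i * (elt j)^-1)%g.

Definition elt_mx g := group_mx (fun x => (x == g)%:R).

Definition subgroup_mx H := group_mx (fun x => (x \in H)%:R).

Definition rcoset_mx H : 'M[R]_(#|rcosets H G|, #|G|) :=
  \matrix_(C, i) (elt i \in (enum_val C : {set gT}))%:R.

Lemma eq_group_mx a b : {in G, a =1 b} -> group_mx a = group_mx b.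
Proof.
move=> eq_ab; apply/matrixP=> i j; rewrite !mxE eq_ab //.
by rewrite groupM ?groupV ?enum_valP.
Qed.

Lemma sum_elt (F : gT -> R) : \sum_(i < #|G|) F (elt i) = \sum_(x in G) F x.
Proof. by rewrite (big_enum_val (A := mem G)). Qed.

Lemma mul_elt_mx g a : g \in G ->
  elt_mx g *m group_mx a = group_mx (fun x => a (g^-1 * x)%g).
Proof.
move=> Gg; apply/matrixP=> i j; rewrite !mxE.
under eq_bigr do rewrite !mxE.
rewrite (sum_elt (fun k => (elt i * k^-1 == g)%g%:R * a (k * (elt j)^-1)%g)).
have Gi := enum_valP i; rewrite (bigD1 (g^-1 * elt i)%g) ?groupM ?groupV //=.
rewrite invMg invgK mulKVg eqxx mul1r big1 ?addr0 ?mulgA // => k /andP[_ neq_k].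
rewrite (negPf (_ : _ != _)) ?mul0r //; apply: contra neq_k => /eqP <-.
by rewrite invMg invgK mulgKV.
Qed.

Lemma mul_mx_elt a g : g \in G ->
  group_mx a *m elt_mx g = group_mx (fun x => a (x * g^-1)%g).
Proof.
move=> Gg; apply/matrixP=> i j; rewrite !mxE.
under eq_bigr do rewrite !mxE.
rewrite (sum_elt (fun k => a (elt i * k^-1)%g * (k * (elt j)^-1 == g)%g%:R)).
have Gj := enum_valP j; rewrite (bigD1 (g * elt j)%g) ?groupM //=.
rewrite mulgK eqxx mulr1 big1 ?addr0 ?invMg ?mulgA // => k /andP[_ neq_k].
rewrite (negPf (_ : _ != _)) ?mulr0 //; apply: contra neq_k => /eqP <-.
by rewrite mulgKV.
Qed.

Lemma elt_mx1 : elt_mx 1 = 1%:M.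
Proof.
apply/matrixP=> i j; rewrite !mxE -eq_mulgV1.
by rewrite (inj_eq enum_val_inj).
Qed.

Lemma elt_mxM g h : g \in G -> elt_mx (g * h)%g = elt_mx g *m elt_mx h.
Proof.
move=> Gg; rewrite mul_elt_mx //; apply: eq_group_mx => x _.
by rewrite -(inj_eq (mulgI g) _ h) mulKVg.
Qed.

Lemma group_mxD a b : group_mx a + group_mx b = group_mx (fun x => a x + b x).
Proof. by apply/matrixP=> i j; rewrite !mxE. Qed.

Lemma group_mxZ (c : R) a : c *: group_mx a = group_mx (fun x => c * a x).
Proof. by apply/matrixP=> i j; rewrite !mxE. Qed.

Lemma group_mx_sum (I : Type) (r : seq I) (F : I -> gT -> R) :
  \sum_(i <- r) group_mx (F i) = group_mx (fun x => \sum_(i <- r) F i x).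
Proof.
by apply/matrixP=> i j; rewrite summxE mxE; apply: eq_bigr => k _; rewrite mxE.
Qed.

Lemma subgroup_mx_elt H g : H \subset G -> g \in H ->
  subgroup_mx H *m elt_mx g = subgroup_mx H.
Proof.
move=> sHG Hg; rewrite mul_mx_elt ?(subsetP sHG) //.
by apply: eq_group_mx => x _; rewrite groupMr ?groupV.
Qed.

(** Right cosets partition [G], so at most the coset of [elt j] contributes to an entry. This
    factorization lets Sylvester's identity pass from size [#|G|] to the index of [H]. *)
Lemma rcoset_mx_trM H : H \subset G ->
  (rcoset_mx H)^T *m rcoset_mx H = subgroup_mx H.
Proof.
move=> sHG; apply/matrixP=> i j; rewrite !mxE.
under eq_bigr do rewrite !mxE.
rewrite -(big_enum_val (fun C : {set gT} => (elt i \in C)%:R * (elt j \in C)%:R)).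
have Gi := enum_valP i; have Gj := enum_valP j.
have rcosetE (C : {set gT}) x : C \in rcosets H G -> x \in C -> C = (H :* x)%g.
  by case/rcosetsP=> y _ -> /rcoset_eqP.
rewrite (bigD1 (H :* elt j)%g) /=; last first.
  by apply/rcosetsP; exists (elt j).
rewrite rcoset_refl mulr1 mem_rcoset big1 ?addr0 // => C /andP[GC neqC].
case: (boolP (elt j \in C)) => [Cj | _]; last by rewrite mulr0.
by rewrite (rcosetE _ _ GC Cj) eqxx in neqC.
Qed.

(** Compression to cosets, applied below to the matrices of [1] and of a nontrivial element of
    [N]. *)
Lemma rcoset_mx_group_mx H a C D : H \subset G ->
  (rcoset_mx H *m group_mx a *m (rcoset_mx H)^T) C D =
    \sum_(x in (enum_val C : {set gT})) \sum_(y in (enum_val D : {set gT}))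
       a (x * y^-1)%g.
Proof.
move=> sHG.
have sub (B : 'I_#|rcosets H G|) : (enum_val B : {set gT}) \subset G.
  have /rcosetsP[x Gx ->] := enum_valP B.
  by rewrite -(rcoset_id Gx) mulSg.
have sum_sub (B : 'I_#|rcosets H G|) (F : gT -> R) :
  \sum_(i < #|G|) (elt i \in (enum_val B : {set gT}))%:R * F (elt i)
    = \sum_(x in (enum_val B : {set gT})) F x.
  rewrite (sum_elt (fun x => (x \in (enum_val B : {set gT}))%:R * F x)).
  rewrite [RHS]big_mkcond [LHS]big_mkcond /=; apply: eq_bigr => x _.
  case: ifP => [_ | nGx]; first by case: ifP; rewrite ?mul1r ?mul0r.
  by case: ifP => // /(subsetP (sub B)); rewrite nGx.
rewrite -mulmxA !mxE.
under eq_bigr => i _.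
  rewrite !mxE.
  under eq_bigr do rewrite !mxE mulrC.
  rewrite (sum_sub _ (fun y => a (elt i * y^-1)%g)).
  over.
exact: (sum_sub _ (fun x => \sum_(y in (enum_val D : {set gT})) a (x * y^-1)%g)).
Qed.

Lemma rcoset_mx_Mtr H : H \subset G ->
  rcoset_mx H *m (rcoset_mx H)^T = #|H|%:R%:M.
Proof.
move=> sHG; rewrite -[X in X *m _]mulmx1 -elt_mx1.
apply/matrixP=> C D; rewrite rcoset_mx_group_mx // !mxE.
have /rcosetsP[y Gy defD] := enum_valP D.
have /rcosetsP[x Gx defC] := enum_valP C.
have [-> | neqCD] := eqVneq C D.
  rewrite defD mulr1n -(card_rcoset H y) -sum1_card natr_sum.
  apply: eq_bigr => z Hz; rewrite (bigD1 z) //= mulgV eqxx big1 ?addr0 //.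
  by move=> u /andP[_ neq_u]; rewrite -eq_mulgV1 eq_sym (negPf neq_u).
rewrite mulr0n big1 // => z Cz; rewrite big1 // => u Du.
rewrite -eq_mulgV1; case: eqP => // zu; case/eqP: neqCD.
apply: enum_val_inj; move: Cz Du; rewrite defC defD -zu => /rcoset_eqP <-.
by move/rcoset_eqP=> <-.
Qed.

End GroupMatrix.

Lemma map_elt_mx (gT : finGroupType) (G : {group gT}) (R R' : comNzRingType)
    (f : {rmorphism R -> R'}) (g : gT) :
  map_mx f (elt_mx G R g) = elt_mx G R' g.
Proof. by apply/matrixP=> i j; rewrite !mxE rmorph_nat. Qed.

Lemma det_mx_perm (R : comNzRingType) (n : nat) (s : 'S_n) (M M' : 'M[R]_n) :
  (forall i j, M (s i) (s j) = M' i j) -> \det M' = \det M.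
Proof.
move=> eqM; have -> : M' = row_perm s (col_perm s M).
  by apply/matrixP=> i j; rewrite !mxE.
rewrite row_permE col_permE !det_mulmx !det_perm mulrC -mulrA -exprD odd_permV.
by rewrite addnn -signr_odd odd_double mulr1.
Qed.

Section CyclicPower.

Variables (gT : finGroupType) (G : {group gT}) (h : gT).
Hypothesis Gh : h \in G.

Let sHG : <[h]>%g \subset G. Proof. by rewrite cycle_subG. Qed.

(* Left multiplications by [h] and [h ^+ m] are conjugate permutations: on a
   coset [<[h]> r] conjugate by [h ^+ i * r |-> h ^+ (i * m) * r]. *)
Lemma elt_mx_expg_conj (R : comNzRingType) (m : nat) : coprime #[h]%g m ->
  exists s : 'S_#|G|, forall g, g \in <[h]>%g ->
    forall i j, elt_mx G R (g ^+ m)%g (s i) (s j) = elt_mx G R g i j.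
Proof.
move=> co_m.
pose r x := repr (<[h]> :* x)%g.
pose phi x := ((x * (r x)^-1) ^+ m * r x)%g.
have Hr x : (x * (r x)^-1)%g \in <[h]>%g.
  by rewrite -mem_rcoset rcoset_repr rcoset_refl.
have phi_rcoset x : (<[h]> :* phi x = <[h]> :* x)%g.
  by rewrite /phi rcosetM rcoset_id ?groupX // rcoset_repr.
have mulV_cycle x y : ((x * y^-1)%g \in <[h]>%g) = (<[h]> :* x == <[h]> :* y)%g.
  by rewrite -mem_rcoset; apply/rcoset_eqP/eqP.
have phi_eq g x y : g \in <[h]>%g ->
  (phi x * (phi y)^-1 == g ^+ m)%g = (x * y^-1 == g)%g.
  (* Since [phi] preserves cosets, both sides fail for distinct cosets; within one coset the
     representatives cancel and powers multiply in the abelian group [<[h]>]. *)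
  move=> Hg; have [eqxy | neqxy] := boolP (<[h]> :* x == <[h]> :* y)%g; last first.
    rewrite (negPf (_ : _ != _)); last first.
      apply: contra neqxy => /eqP phi_xy.
      by rewrite -phi_rcoset -(phi_rcoset y) -mulV_cycle phi_xy groupX.
    by apply/esym/negP=> /eqP xy; rewrite -mulV_cycle xy Hg in neqxy.
  have rE : r x = r y by rewrite /r (eqP eqxy).
  have -> : (phi x * (phi y)^-1 = (x * y^-1) ^+ m)%g.
    rewrite /phi rE invMg mulgA mulgK -expgVn -expgMn; last first.
      rewrite -rE; apply: (centsP (cycle_abelian h)); first exact: Hr.
      by rewrite rE groupV Hr.
    by rewrite invMg invgK mulgA mulgKV.
  have Hxy : (x * y^-1)%g \in <[h]>%g by rewrite mulV_cycle.
  apply/eqP/eqP=> [|-> //].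
  by apply: (can_in_inj (expgK co_m)).
have Gphi x : x \in G -> phi x \in G.
  move=> Gx; have : (phi x * x^-1)%g \in G.
    by rewrite (subsetP sHG) // mulV_cycle phi_rcoset.
  by rewrite groupMr ?groupV.
pose f (i : 'I_#|G|) := enum_rank_in (group1 G) (phi (enum_val i)).
have fE i : enum_val (f i) = phi (enum_val i).
  by rewrite enum_rankK_in ?Gphi ?enum_valP.
have inj_f : injective f.
  move=> i j /(congr1 enum_val); rewrite !fE => eq_phi; apply: enum_val_inj.
  have := phi_eq 1%g (enum_val i) (enum_val j) (group1 _).
  by rewrite eq_phi expg1n mulgV eqxx -eq_mulgV1 => /esym/eqP.
exists (perm inj_f) => g Hg i j.
by rewrite !mxE !permE !fE phi_eq.
Qed.

Lemma geom_elt_mx (R : comNzRingType) (x : R) (m : nat) :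
  (\sum_(i < m) x ^+ i *: elt_mx G R (h ^+ i)%g) *m (1%:M - x *: elt_mx G R h)
    = 1%:M - x ^+ m *: elt_mx G R (h ^+ m)%g.
Proof.
elim: m => [|m IHm].
  by rewrite big_ord0 mul0mx expg0 elt_mx1 expr0 scale1r subrr.
rewrite big_ord_recr /= mulmxDl IHm mulmxBr mulmx1 -scalemxAl -scalemxAr.
by rewrite -elt_mxM ?groupX // -expgSr scalerA -exprSr addrA subrK.
Qed.

(** The exponent is the multiplicity of 1 as a root of [F], hence the same for every [m]. *)
Lemma det_sum_elt_mx_expn :
  exists e, forall m, coprime #[h]%g m ->
    \det (\sum_(i < m) elt_mx G int (h ^+ i)%g) = m%:Z ^+ e.
Proof.
pose F := \det (1%:M - 'X *: elt_mx G {poly int} h).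
(* The constant term shows that [F] is nonzero, so the multiplicity is well defined. *)
have F0 : F.[0] = 1.
  rewrite -horner_evalE -det_map_mx -[RHS](det1 _ #|G|); congr (\det _).
  by rewrite map_mxB map_mxZ map_mx1 /= horner_evalE hornerX scale0r subr0.
have F_neq0 : F != 0.
  by apply/eqP=> F_eq0; move: F0; rewrite F_eq0 horner0.
have [e [Q]] := multiplicity_XsubC F 1; rewrite F_neq0 /= => rootQ FE.
exists e => m co_m.
pose U := \sum_(i < m) 'X^i *: elt_mx G {poly int} (h ^+ i)%g.
(* The substitution turns ['X] into ['X^m] but leaves [h] in place; the permutation [s] replaces [h]
   by [h ^+ m] and fixes the identity matrix. *)
have FXm : F \Po 'X^m = \det U * F.
  rewrite -det_mulmx geom_elt_mx -[F \Po _]/(comp_poly 'X^m F) -det_map_mx.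
  rewrite map_mxB map_mxZ map_mx1 map_elt_mx /= comp_polyX.
  have [s sE] := elt_mx_expg_conj {poly int} co_m.
  apply: (det_mx_perm (s := s)) => i j.
  have := sE h (cycle_id h) i j; have := sE 1%g (group1 _) i j.
  rewrite expg1n elt_mx1 => s1 sh.
  have subE (M N : 'M[{poly int}]_#|G|) c k l : (M - c *: N) k l = M k l - c * N k l.
    by rewrite !mxE.
  by rewrite !subE s1 sh.
pose V : {poly int} := \sum_(i < m) 'X^i.
(* As ['X^m - 1] is ['X - 1] times [V], the power of ['X - 1] cancels. At 1, [V] takes the value [m]
   and [Q] does not vanish. *)
have UQ : \det U * Q = (Q \Po 'X^m) * V ^+ e.
  have nz : ('X - 1%:P : {poly int}) ^+ e != 0 by rewrite expf_neq0 ?polyXsubC_eq0.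
  apply: (mulIf nz).
  rewrite -mulrA -FE -FXm FE comp_polyM rmorphXn /= comp_polyB comp_polyX comp_polyC.
  by rewrite -mulrA -exprMn mulrC subrX1 [_ * V]mulrC mulrC.
have := congr1 (horner_eval 1) UQ.
rewrite !rmorphM rmorphXn -det_map_mx /= !horner_evalE horner_comp hornerXn expr1n.
rewrite mulrC => /(mulfI rootQ).
rewrite rmorph_sum /= horner_sum.
under eq_bigr => i _ do rewrite map_mxZ map_elt_mx /= horner_evalE hornerXn expr1n scale1r.
move=> ->; under eq_bigr => i _ do rewrite hornerXn expr1n.
by rewrite sumr_const card_ord natz.
Qed.

Lemma det_sum_elt_mx (m : nat) : coprime #[h]%g m ->
  \det (\sum_(i < m) elt_mx G int (h ^+ i)%g) = m%:Z ^+ #|G : <[h]>|%g.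
Proof.
have [e detE] := det_sum_elt_mx_expn => /detE ->; congr (_ ^+ _).
(* A test value of [m] that determines [e]: the powers of [h] run once through [<[h]>] and then
   repeat [1], and Sylvester's identity evaluates the resulting determinant directly. *)
have := detE #[h]%g.+1 (coprimenS _).
rewrite big_ord_recr /= expg_order elt_mx1.
have -> : \sum_(i < #[h]%g) elt_mx G int (h ^+ i)%g = subgroup_mx G int <[h]>%G.
  rewrite group_mx_sum; apply: eq_group_mx => x _.
  have [/cyclePmin[k lt_k ->] | Hx] := boolP (x \in <[h]>%g); last first.
    rewrite big1 // => i _; case: eqP => // xE; case/negP: Hx.
    by rewrite xE mem_cycle.
  rewrite (bigD1 (Ordinal lt_k)) //= eqxx big1 ?addr0 // => i neq_ik.
  rewrite eq_expg_mod_order !modn_small // (negPf (_ : k != i)) //.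
  by rewrite eq_sym; apply: contra neq_ik => /eqP eq_ik; apply/eqP/val_inj.
have := mul_det_scalar_add 1 (rcoset_mx G int <[h]>%G)^T (rcoset_mx G int <[h]>%G).
rewrite rcoset_mx_trM // rcoset_mx_Mtr // !expr1n !mul1r addrC => ->.
rewrite -raddfD det_scalar natz -PoszD add1n.
(* The common base [#[h] + 1] exceeds 1, so the exponents agree. *)
move/eqP; rewrite -!natz -!natrX eqr_nat eqn_exp2l ?ltnS ?order_gt0 //.
by move/eqP.
Qed.

End CyclicPower.

(** * Semidirect products with a sharply transitive complement *)

Section SharplyTransitiveComplement.

Variables (gT : finGroupType) (G N H : {group gT}).
Hypothesis defG : (N ><| H = G)%g.
Hypothesis regH : semiregular N H.
Hypothesis cardN : #|N| = #|H|.+1.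

Let sHG : H \subset G. Proof. by case/sdprod_context: defG. Qed.

Let index_HG : #|G : H|%g = #|N|.
Proof. by rewrite -divgS // -(sdprod_card defG) mulnK. Qed.

(** Semiregularity makes the orbit free; having [#|H|] elements, it fills [N^#] by [cardN]. *)
Lemma conj_orbit_sharp (x : gT) : x \in N^#%g ->
  {in H &, injective (fun k => x ^ k)%g} /\ [set (x ^ k)%g | k in H] = N^#%g.
Proof.
case/setD1P=> x1 Nx; have [_ _ nNH _] := sdprodP defG.
have inj_x : {in H &, injective (fun k => x ^ k)%g}.
  move=> k l Hk Hl /= eq_kl; apply/eqP; rewrite eq_mulgV1; apply/negPn/negP=> kl1.
  have : x \in 'C_N[k * l^-1]%g.
    rewrite inE Nx; apply/cent1P/commgP/conjg_fixP.
    by rewrite conjgM eq_kl conjgK.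
  by rewrite regH ?inE ?(negPf x1) ?kl1 ?groupM ?groupV.
split=> //; apply/eqP; rewrite eqEcard card_in_imset // cardsDS ?sub1G //.
rewrite cards1 cardN subn1 leqnn andbT; apply/subsetP=> _ /imsetP[k Hk ->].
by rewrite !inE conjg_eq1 x1 memJ_norm ?(subsetP nNH).
Qed.

(** With coset representatives [u], [v] in [N], the entry counts the [k] in [H] with
    [x ^ k = u * v^-1]: exactly one if [u != v], none otherwise. *)
Lemma rcoset_mx_elt (x : gT) : x \in N^#%g ->
  rcoset_mx G int H *m elt_mx G int x *m (rcoset_mx G int H)^T
    = const_mx 1 - 1%:M.
Proof.
move=> Nx; have [inj_x im_x] := conj_orbit_sharp Nx.
have [_ defNH nNH tiNH] := sdprodP defG.
have rep (C : 'I_#|rcosets H G|) :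
  exists2 u, u \in N & enum_val C = (H :* u)%g :> {set gT}.
  have /rcosetsP[g Gg ->] := enum_valP C.
  have : g \in (H * N)%g by rewrite (normC nNH) defNH.
  by case/mulsgP=> k u Hk Nu ->; exists u => //; rewrite rcosetM rcoset_id.
apply/matrixP=> C D; rewrite rcoset_mx_group_mx // !mxE.
have [u Nu defC] := rep C; have [v Nv defD] := rep D.
have -> : (C == D) = (u * v^-1 == 1)%g.
  rewrite -(inj_eq enum_val_inj) defC defD; apply/eqP/eqP=> [/rcoset_eqP | uv1].
    rewrite mem_rcoset => Huv; apply/set1gP; rewrite -tiNH inE Huv.
    by rewrite groupM ?groupV.
  by apply/rcoset_eqP; rewrite mem_rcoset uv1.
rewrite exchange_big defC defD /=.
transitivity (\sum_(k in H) ((x ^ k)%g == u * v^-1)%g%:R : int).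
  rewrite (reindex_inj (mulIg v)) /=; apply: eq_big => [k | k].
    by rewrite mem_rcoset mulgK.
  rewrite mem_rcoset mulgK => Hk.
  have Nxk : (x ^ k)%g \in N.
    by have : (x ^ k)%g \in N^#%g; [rewrite -im_x imset_f | case/setD1P].
  (* The element [x * (k * v) * u^-1] is [k] times an element of [N], so it lies in [H] only when
     that element is trivial. *)
  have -> : ((x ^ k)%g == u * v^-1)%g = (x * (k * v) \in H :* u)%g.
    have E : (x * (k * v) * u^-1 = k * (x ^ k * (v * u^-1)))%g.
      by rewrite conjgE !mulgA mulgV mul1g.
    rewrite mem_rcoset E groupMl //.
    apply/eqP/idP=> [-> | Hxk]; first by rewrite mulgA mulgKV mulgV.
    apply/eqP; rewrite eq_mulgV1 invMg invgK; apply/eqP/set1gP.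
    by rewrite -tiNH inE Hxk andbT (groupM Nxk) // (groupM Nv) ?groupV.
  have [Hxk | nHxk] := boolP (x * (k * v) \in H :* u)%g.
    rewrite (bigD1 (x * (k * v))%g) //= mulgK eqxx big1 ?addr0 // => y.
    case/andP=> _; apply: contraNeq; rewrite pnatr_eq0 eqb0 negbK => /eqP <-.
    by rewrite mulgKV.
  rewrite big1 // => y Hy; case: eqP => // yx; case/negP: nHxk.
  by rewrite -yx mulgKV.
rewrite -(big_imset (fun w => (w == u * v^-1)%g%:R) inj_x) /= im_x.
have [uv1 | uv_neq1] := eqVneq (u * v^-1)%g 1%g.
  rewrite subrr big1 // => w; rewrite uv1 => /setD1P[/negPf -> //].
rewrite subr0 (bigD1 (u * v^-1)%g) /=; last by rewrite !inE uv_neq1 groupM ?groupV.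
by rewrite eqxx big1 ?addr0 // => w /andP[_ /negPf ->].
Qed.

Lemma sdprod_is_int_group_det (A B : int) :
  cyclic H -> coprimez A #|H|%:Z -> (B == A %[mod #|N|%:Z])%Z ->
  is_int_group_det G (A * B ^+ #|H|).
Proof.
case/cyclicP=> h defH coA; rewrite eqz_mod_dvd => /dvdzP[c defB].
have Hh : h \in H by rewrite defH cycle_id.
have [x Nx] : exists x, x \in N^#%g.
  apply/set0Pn; rewrite -card_gt0 cardsDS ?sub1G // cards1 cardN subn1.
  exact: cardG_gt0.
(* A large multiple of [#|H|] makes [m] positive: it must be a natural number, and its powers are
   cancelled at the end. *)
have [m m_gt0 [t defA]] : exists2 m : nat, (0 < m)%N & exists t, A = m%:Z + t * #|H|%:Z.
  have H_gt0 := cardG_gt0 H.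
  have : 0 < A + (`|A| + 1) * #|H|%:Z by nia.
  case E : (A + (`|A| + 1) * #|H|%:Z) => [m|//] m_gt0; exists m => //.
  by exists (- (`|A| + 1)); rewrite -E mulNr addrK.
have co_m : coprime #[h]%g m.
  rewrite orderE -defH -[coprime _ _]/(coprime `|#|H|%:Z|%N `|m%:Z|%N) -coprimezE.
  by move: coA; rewrite defA addrC coprimez_sym /coprimez gcdzMDl.
pose S := subgroup_mx G int H.
pose U := \sum_(i < m) elt_mx G int (h ^+ i)%g.
pose P := rcoset_mx G int H.
pose X := (t + c)%:M - c *: elt_mx G int x.
have Gx : x \in G by case/setD1P: Nx => _; apply: subsetP; case/sdprod_context: defG => /andP[].
pose a y : int := \sum_(i < m) (y == h ^+ i)%g%:R
  + ((t + c) * (y \in H)%:R + - c * (x^-1 * y \in H)%g%:R).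
exists a; rewrite -[LHS]/(\det (group_mx G a)).
have aE : group_mx G a = U + X *m S.
  rewrite mulmxBl mul_scalar_mx -scalemxAl mul_elt_mx // -scaleNr /U group_mx_sum.
  by rewrite !group_mxZ !group_mxD.
have SU : S *m U = m%:Z *: S.
  rewrite mulmx_sumr.
  under eq_bigr do rewrite subgroup_mx_elt ?groupX //.
  by rewrite sumr_const card_ord -scaler_nat natz.
(* Multiplying by [m] makes [U] a right factor, because [S *m U] is [m] times [S]. *)
have mul_a : m%:Z *: group_mx G a = (m%:Z%:M + X *m S) *m U.
  by rewrite mulmxDl mul_scalar_mx -mulmxA SU -scalemxAr -scalerDr aE.
have := mul_det_scalar_add m%:Z (X *m P^T) P.
rewrite -mulmxA rcoset_mx_trM // -/S.
have -> : m%:Z%:M + P *m (X *m P^T) = B%:M - const_mx c.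
  rewrite mulmxA mulmxBr mul_mx_scalar -scalemxAr mulmxBl -!scalemxAl.
  rewrite rcoset_mx_elt // rcoset_mx_Mtr //.
  (* The last [c] comes from the identity matrix in [const_mx 1 - 1%:M], which enters with
     coefficient [- c]. *)
  have -> : B = m%:Z + (t + c) * #|H|%:Z + c.
    by rewrite -[B](subrK A) defB defA cardN; lia.
  by apply/matrixP=> i j; rewrite !mxE -natz; case: eqP => _; rewrite ?mulr1n ?mulr0n; ring.
rewrite det_scalar_sub_const; last by rewrite [#|_|]index_HG cardN ltnS cardG_gt0.
rewrite [#|rcosets H G|]index_HG cardN /=.
have -> : B - c * #|H|.+1%:Z = A by rewrite -cardN -defB opprB addrC subrK.
move=> detX; have := congr1 determinant mul_a.
rewrite detZ det_mulmx (det_sum_elt_mx _ co_m) ?(subsetP sHG) //.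
have -> : #|G : <[h]>|%g = #|H|.+1 by rewrite -defH index_HG.
move/(congr1 ( *%R (m%:Z ^+ #|H|.+1))); rewrite !mulrA detX => detE.
have m_neq0 : m%:Z != 0 by rewrite eqz_nat -lt0n.
(* The powers of [m] from Sylvester's identity and from [\det U] balance and cancel. *)
apply: (mulfI (expf_neq0 #|G| m_neq0)); apply: (mulfI (expf_neq0 #|H|.+1 m_neq0)).
by rewrite mulrA detE; ring.
Qed.

End SharplyTransitiveComplement.

(** * The affine group as translations extended by dilations *)

Section GeneralAffineGroup.

Variable F : finFieldType.

Local Notation o0 := (@Ordinal 2 0 isT).
Local Notation o1 := (@Ordinal 2 1 isT).

Definition slope (g : {'GL_2[F]}) : F := GLval g o0 o0.

Definition shift (g : {'GL_2[F]}) : F := GLval g o0 o1.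

Definition affine_mx (a b : F) : 'M[F]_2 :=
  \matrix_(i, j) if i == o0 then if j == o0 then a else b else (j == o1)%:R.

(** For [a = 0] the matrix is singular and the value is the default [1]. *)
Definition affine_elt (a b : F) : {'GL_2[F]} := insubd (1%g : {'GL_2[F]}) (affine_mx a b).

Lemma affine_eltE (a b : F) : a != 0 -> GLval (affine_elt a b) = affine_mx a b.
Proof.
move=> a_neq0; apply: (insubdK (1%g : {'GL_2[F]})).
have E : \det (affine_mx a b) = a.
  rewrite (expand_det_col _ o0) big_ord_recl big_ord1 !mxE /= mul0r addr0.
  by rewrite /cofactor det_mx11 !mxE /= expr0 !mul1r mulr1.
by rewrite -[_ \in _]/(affine_mx a b \in unitmx) unitmxE E unitfE.
Qed.

Lemma affine_elt_GA1 (a b : F) : a != 0 -> affine_elt a b \in GA1 F.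
Proof. by move=> a_neq0; rewrite inE affine_eltE // !mxE /= !eqxx. Qed.

Lemma slope_affine_elt (a b : F) : a != 0 -> slope (affine_elt a b) = a.
Proof. by move=> a_neq0; rewrite /slope affine_eltE // mxE. Qed.

Lemma shift_affine_elt (a b : F) : a != 0 -> shift (affine_elt a b) = b.
Proof. by move=> a_neq0; rewrite /shift affine_eltE // mxE. Qed.

Lemma mulGL2E (g h : {'GL_2[F]}) (i j : 'I_2) :
  GLval (g * h)%g i j = GLval g i o0 * GLval h o0 j + GLval g i o1 * GLval h o1 j.
Proof.
rewrite GL_MxE mxE big_ord_recl big_ord1.
by congr (GLval g i _ * GLval h _ j + GLval g i _ * GLval h _ j); apply: val_inj.
Qed.

Lemma GA1P (g : {'GL_2[F]}) :
  reflect (GLval g o1 o0 = 0 /\ GLval g o1 o1 = 1) (g \in GA1 F).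
Proof. by rewrite inE; apply: (iffP andP) => -[/eqP ? /eqP ?]. Qed.

Lemma slopeM : {in GA1 F &, {morph slope : g h / (g * h)%g >-> g * h}}.
Proof.
by move=> g h _ /GA1P[h10 _]; rewrite /slope mulGL2E h10 mulr0 addr0.
Qed.

Lemma shiftM : {in GA1 F &, forall g h,
  shift (g * h)%g = slope g * shift h + shift g}.
Proof.
by move=> g h _ /GA1P[_ h11]; rewrite /shift mulGL2E h11 mulr1.
Qed.

Lemma GA1_inj (g h : {'GL_2[F]}) : g \in GA1 F -> h \in GA1 F ->
  slope g = slope h -> shift g = shift h -> g = h.
Proof.
move=> /GA1P[g10 g11] /GA1P[h10 h11] eq_slope eq_shift; apply: val_inj.
apply/matrixP=> -[[|[|//]] lt_i] [[|[|//]] lt_j];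
  rewrite (bool_irrelevance lt_i isT) (bool_irrelevance lt_j isT) //=.
- by rewrite g10 h10.
- by rewrite g11 h11.
Qed.

Lemma slope1 : slope 1%g = 1.
Proof. by rewrite /slope mxE. Qed.

Lemma shift1 : shift 1%g = 0.
Proof. by rewrite /shift mxE. Qed.

Lemma GA1_group_set : group_set (GA1 F).
Proof.
apply/group_setP; split=> [|g h /GA1P[g10 g11] /GA1P[h10 h11]].
  by apply/GA1P; rewrite !mxE.
by apply/GA1P; rewrite !mulGL2E g10 g11 h10 h11 !mul0r !mul1r !add0r.
Qed.

Canonical GA1_group := Group GA1_group_set.

Lemma slope_neq0 (g : {'GL_2[F]}) : g \in GA1 F -> slope g != 0.
Proof.
move=> Gg; have := slopeM Gg (groupVr Gg); rewrite mulgV slope1 => E.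
by apply/eqP=> g0; move/eqP: E; rewrite g0 mul0r oner_eq0.
Qed.

Definition translations : {set {'GL_2[F]}} := [set g in GA1 F | slope g == 1].

Definition dilations : {set {'GL_2[F]}} := [set g in GA1 F | shift g == 0].

Lemma translationsP (g : {'GL_2[F]}) :
  reflect (g \in GA1 F /\ slope g = 1) (g \in translations).
Proof. by rewrite [g \in translations]in_set; apply: (iffP andP) => -[? /eqP ?]. Qed.

Lemma dilationsP (g : {'GL_2[F]}) :
  reflect (g \in GA1 F /\ shift g = 0) (g \in dilations).
Proof. by rewrite [g \in dilations]in_set; apply: (iffP andP) => -[? /eqP ?]. Qed.

Lemma translations_group_set : group_set translations.
Proof.
apply/group_setP; split=> [|g h /translationsP[Gg g1] /translationsP[Gh h1]].
  by apply/translationsP; rewrite group1 slope1.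
by apply/translationsP; rewrite groupM // slopeM // g1 h1 mulr1.
Qed.

Canonical translations_group := Group translations_group_set.

Lemma dilations_group_set : group_set dilations.
Proof.
apply/group_setP; split=> [|g h /dilationsP[Gg g0] /dilationsP[Gh h0]].
  by apply/dilationsP; rewrite group1 shift1.
by apply/dilationsP; rewrite groupM // shiftM // g0 h0 mulr0 addr0.
Qed.

Canonical dilations_group := Group dilations_group_set.

Lemma card_translations : #|translations| = #|F|.
Proof.
rewrite -(card_in_imset (f := shift)).
  rewrite -cardsT; apply: eq_card => b; rewrite inE; apply/imsetP.
  have nz1 := oner_neq0 F; exists (affine_elt 1 b); last by rewrite shift_affine_elt.
  by apply/translationsP; rewrite affine_elt_GA1 ?slope_affine_elt.
move=> g h /translationsP[Gg g1] /translationsP[Gh h1].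
by apply: GA1_inj; rewrite ?g1.
Qed.

Lemma card_dilations : #|dilations| = #|F|.-1.
Proof.
rewrite -(card_in_imset (f := slope)).
  rewrite -(cardsC1 (0 : F)); apply: eq_card => a; rewrite !inE.
  apply/imsetP/idP => [[g /dilationsP[Gg _] ->] | a_neq0]; first exact: slope_neq0.
  exists (affine_elt a 0); last by rewrite slope_affine_elt.
  by apply/dilationsP; rewrite affine_elt_GA1 ?shift_affine_elt.
move=> g h /dilationsP[Gg g0] /dilationsP[Gh h0] eq_slope.
by apply: GA1_inj; rewrite ?g0.
Qed.

Lemma sdprod_GA1 : (translations ><| dilations)%g = GA1 F.
Proof.
rewrite sdprodE.
- apply/eqP; rewrite eqEsubset; apply/andP; split.
    apply/subsetP=> _ /mulsgP[g k /translationsP[Gg _] /dilationsP[Gk _] ->].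
    exact: groupM.
  apply/subsetP=> g Gg; have g_neq0 := slope_neq0 Gg.
  (* Splitting off on the right the dilation with the slope of [g] leaves a translation. *)
  have Gk := affine_elt_GA1 0 g_neq0; set k := affine_elt _ _ in Gk.
  have Hk : k \in dilations by apply/dilationsP; rewrite Gk shift_affine_elt.
  apply/mulsgP; exists (g * k^-1)%g k; rewrite ?mulgKV //.
  have Ggk : (g * k^-1)%g \in GA1 F by rewrite groupM ?groupV.
  apply/translationsP; split=> //; apply: (mulIf g_neq0); rewrite mul1r.
  by rewrite -[X in _ * X](slope_affine_elt 0 g_neq0) -slopeM ?mulgKV.
- apply/subsetP=> k /dilationsP[Gk _]; rewrite inE.
  apply/subsetP=> _ /imsetP[g /translationsP[Gg g1] ->]; apply/translationsP.
  have GVk : k^-1%g \in GA1 F by rewrite groupV.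
  rewrite conjgE !groupM //; split=> //.
  by rewrite !slopeM ?groupM // g1 mul1r -slopeM // mulVg slope1.
- apply/eqP; rewrite eqEsubset sub1G andbT; apply/subsetP=> g.
  case/setIP=> /translationsP[Gg g1] /dilationsP[_ g0]; apply/set1gP.
  by apply: GA1_inj; rewrite ?group1 ?slope1 ?shift1.
Qed.

(** If the translation by [b] commutes with the dilation by [a], then [a * b = b], so [a = 1] or
    [b = 0]. *)
Lemma semiregular_dilations : semiregular translations dilations.
Proof.
move=> k /setD1P[k1 /dilationsP[Gk k0]].
apply/eqP; rewrite eqEsubset sub1G andbT; apply/subsetP=> g.
case/setIP=> /translationsP[Gg g1] /cent1P gk.
have := congr1 shift gk; rewrite !shiftM // k0 g1 mulr0 add0r addr0.
move/eqP; rewrite eq_sym -subr_eq0 -[X in _ - X]mul1r -mulrBl mulf_eq0 subr_eq0.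
case/orP=> /eqP E; last by apply/set1gP; apply: GA1_inj; rewrite ?group1 ?slope1 ?shift1.
by case/eqP: k1; apply: GA1_inj; rewrite ?group1 ?slope1 ?shift1.
Qed.

(** The map [slope] embeds the dilations in the multiplicative group of a field, whose finite
    subgroups are cyclic. *)
Lemma cyclic_dilations : cyclic dilations.
Proof.
apply: (field_mul_group_cyclic (f := slope)).
  by move=> g h /dilationsP[Gg _] /dilationsP[Gh _]; apply: slopeM.
move=> g /dilationsP[Gg g0]; split=> [g1 | ->]; last exact: slope1.
by apply: GA1_inj; rewrite ?group1 ?slope1 ?shift1.
Qed.

End GeneralAffineGroup.

Theorem theorem2 (p k : nat) (F : finFieldType) (A B : int) :
  prime p -> (0 < k)%N -> #|F| = (p ^ k)%N ->
  coprimez A (p ^ k).-1%:Z ->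
  (B == A %[mod (p ^ k)%:Z])%Z ->
  is_int_group_det (GA1 F) (A * B ^+ (p ^ k).-1).
Proof.
(* Folding [#|F|.-1] first leaves only the modulus [#|F|] to become the order of the
   translations. *)
move=> _ _ <-; rewrite -card_dilations -card_translations => coA eqBA.
apply: (sdprod_is_int_group_det (sdprod_GA1 F) (semiregular_dilations (F := F))) => //.
  by rewrite card_translations card_dilations prednK // (cardD1 0).
exact: cyclic_dilations.
Qed.
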